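(* Let $M$ be a matroid of rank $r$ on the ground set $E=\{1,\dots,n\}$ and let $(E_1,E_2)$ be a good partition of $E$ with associated integers $r_1,r_2,a_1,a_2$. Let $M_1,M_2$ be the matroids on $E$ with bases $$\mathcal{B}(M_1)=\{B\in\mathcal{B}(M): |B\cap E_1|\le r_1-a_1\},\qquad \mathcal{B}(M_2)=\{B\in\mathcal{B}(M): |B\cap E_2|\le r_2-a_2\}.$$ Then $P(M)=P(M_1)\cup P(M_2)$ is a nontrivial hyperplane split of $P(M)$.
   Context: For a matroid $N$ on $E=\{1,\dots,n\}$ with set of bases $\mathcal{B}(N)$, the matroid base polytope is $P(N)=\mathrm{conv}\{\sum_{i\in B}e_i : B\in\mathcal{B}(N)\}\subset\mathbb{R}^n$, where $e_i$ is the $i$-th standard basis vector. A hyperplane split of $P(M)$ is an expression $P(M)=P(M_1)\cup P(M_2)$ with $M_1,M_2$ matroids on $E$ such that $P(M_1)\cap P(M_2)$ is a face of both $P(M_1)$ and $P(M_2)$; it is nontrivial if $P(M_1)\neq P(M)$ and $P(M_2)\neq P(M)$. For $A\subseteq E$, $M|_A$ denotes the restriction of $M$ to $A$, and $\mathcal{I}(N)$ the independent sets of $N$. A partition $(E_1,E_2)$ of $E$ with $r_i$ the rank of $M|_{E_i}$ and $r_i>1$ ($i=1,2$) is a good partition if there exist integers $0<a_1<r_1$, $0<a_2<r_2$ such that (P1) $r_1+r_2=r+a_1+a_2$ and (P2) for every $X\in\mathcal{I}(M|_{E_1})$ with $|X|\le r_1-a_1$ and every $Y\in\mathcal{I}(M|_{E_2})$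 with $|Y|\le r_2-a_2$, $X\cup Y\in\mathcal{I}(M)$. (These $\mathcal{B}(M_1),\mathcal{B}(M_2)$ are indeed collections of bases of matroids.) *)

(* Defs.v *)
From HB Require Import structures.
From mathcomp Require Import all_boot all_order all_algebra.
Set Implicit Arguments. Unset Strict Implicit. Unset Printing Implicit Defensive.
Import Order.TTheory GRing.Theory Num.Theory.
Local Open Scope ring_scope.

Section Matroids.
Variable n : nat.
Notation set := {set 'I_n}.

Definition matroid_bases (Bs : {set set}) : Prop :=
  Bs != set0 /\
  forall B1 B2, B1 \in Bs -> B2 \in Bs -> forall x, x \in B1 :\: B2 ->
    exists2 y, y \in B2 :\: B1 & (y |: (B1 :\ x)) \in Bs.

Definition indep (Bs : {set set}) (X : set) : bool :=
  [exists B in Bs, X \subset B].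

Definition mrank (Bs : {set set}) (A : set) : nat :=
  \max_(B in Bs) #|B :&: A|.

Definition mrk (Bs : {set set}) : nat := mrank Bs setT.

Definition good_partition_with (Bs : {set set}) (E1 E2 : set) (a1 a2 : nat) : Prop :=
  let r := mrk Bs in let r1 := mrank Bs E1 in let r2 := mrank Bs E2 in
  [/\ (1 < r1)%N /\ (1 < r2)%N,
      (0 < a1 < r1)%N, (0 < a2 < r2)%N,
      (r1 + r2 = r + a1 + a2)%N &
      forall X Y : set,
        X \subset E1 -> indep Bs X -> (#|X| <= r1 - a1)%N ->
        Y \subset E2 -> indep Bs Y -> (#|Y| <= r2 - a2)%N ->
        indep Bs (X :|: Y)].

Variable R : realFieldType.

Definition indicator (B : set) : 'rV[R]_n := \row_i (if i \in B then 1 else 0).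

Definition base_polytope (Bs : {set set}) (x : 'rV[R]_n) : Prop :=
  exists w : set -> R,
    [/\ forall B, 0 <= w B,
        \sum_(B in Bs) w B = 1 &
        x = \sum_(B in Bs) w B *: indicator B].

Definition dotv (c x : 'rV[R]_n) : R := \sum_i c 0 i * x 0 i.

Definition is_face (P F : 'rV[R]_n -> Prop) : Prop :=
  exists (c : 'rV[R]_n) (d : R),
    (forall x, P x -> dotv c x <= d) /\
    (forall x, F x <-> (P x /\ dotv c x = d)).

Definition same_pred (P Q : 'rV[R]_n -> Prop) : Prop := forall x, P x <-> Q x.

Definition hyperplane_split (Bs Bs1 Bs2 : {set set}) : Prop :=
  let P := base_polytope Bs in
  let P1 := base_polytope Bs1 in
  let P2 := base_polytope Bs2 in
  [/\ matroid_bases Bs1, matroid_bases Bs2,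
      same_pred P (fun x => P1 x \/ P2 x),
      is_face P1 (fun x => P1 x /\ P2 x) &
      is_face P2 (fun x => P1 x /\ P2 x)].

Definition nontrivial_hyperplane_split (Bs Bs1 Bs2 : {set set}) : Prop :=
  [/\ hyperplane_split Bs Bs1 Bs2,
      ~ same_pred (base_polytope Bs1) (base_polytope Bs) &
      ~ same_pred (base_polytope Bs2) (base_polytope Bs)].

End Matroids.

(* Main.v *)
Require Import Defs.
From HB Require Import structures.
From mathcomp Require Import all_boot all_order all_algebra.
From mathcomp Require Import zify ring lra.

(** Put k1 = r1 - a1 and k2 = r2 - a2, so that k1 + k2 = r and the splitting
    hyperplane is x(E1) = k1. It suffices to prove that P(M1) is the part of
    P(M) where x(E1) <= k1, since the situation is symmetric in (E1, E2) and
    x(E1) + x(E2) = r on P(M). A convex combination x of bases with x(E1) <= k1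
    is decomposed into bases below the hyperplane and a point of P(M) on it. For
    such a point, the two projections to E1 and E2 are averages of independent
    sets of mean sizes k1 and k2; exchanging elements between small and large
    independent sets turns them into averages of sets of exactly these sizes,
    whose unions are bases by (P2). *)

Set Implicit Arguments. Unset Strict Implicit. Unset Printing Implicit Defensive.
Import Order.TTheory GRing.Theory Num.Theory.

(** * Bases, independent sets and augmentation *)

Section MatroidBases.
Variables (n : nat) (Bs : {set {set 'I_n}}).
Hypothesis matBs : matroid_bases Bs.
Implicit Types (A B C I J X Y E : {set 'I_n}).

Lemma base_exchange B C x : B \in Bs -> C \in Bs -> x \in B :\: C ->
  exists2 y, y \in C :\: B & (y |: (B :\ x)) \in Bs.
Proof. by move=> BB BC; apply: matBs.2. Qed.

Lemma card_swap B x y : x \in B -> y \notin B -> #|y |: (B :\ x)| = #|B|.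
Proof.
move=> xB yB; rewrite cardsU1 !inE (negbTE yB) andbF (cardsD1 x B) xB.
by [].
Qed.

(** Each exchange keeps the size of B and removes an element from [B :\: C], so after finitely many
    exchanges B lies inside C. *)
Lemma card_bases_le B C : B \in Bs -> C \in Bs -> #|B| <= #|C|.
Proof.
move=> + BC; move: {2}#|B :\: C| (leqnn #|B :\: C|) => d.
elim: d B => [|d IHd] B.
  by rewrite leqn0 cards_eq0 setD_eq0 => /subset_leq_card.
move=> leBC BB; have [sBC|] := boolP (B \subset C).
  exact: subset_leq_card.
rewrite -setD_eq0 => /set0Pn[x xBC].
have [y yCB BB'] := base_exchange BB BC xBC.
move: xBC yCB; rewrite !inE => /andP[xC xB] /andP[yB yC].
rewrite -(card_swap xB yB); apply: IHd BB'.
rewrite -ltnS; apply: leq_trans leBC; apply: proper_card.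
apply/properP; split; last first.
  exists x; rewrite !inE xC //= eqxx /= orbF.
  by apply: contraNneq xC => ->.
apply/subsetP => z; rewrite !inE => /andP[zC].
by case/orP => [/eqP zy | /andP[_ ->]]; [rewrite zy yC in zC | rewrite zC].
Qed.

Lemma card_base B : B \in Bs -> #|B| = mrk Bs.
Proof.
move=> BB; rewrite /mrk /mrank; apply/eqP; rewrite eqn_leq; apply/andP; split.
  by have := @leq_bigmax_cond _ [in Bs] (fun B => #|B :&: setT|) B BB; rewrite setIT.
by apply/bigmax_leqP => C BC; rewrite setIT card_bases_le.
Qed.

Lemma indepP X : reflect (exists2 B, B \in Bs & X \subset B) (indep Bs X).
Proof. exact: exists_inP. Qed.

Lemma indep_sub X Y : X \subset Y -> indep Bs Y -> indep Bs X.
Proof.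
by move=> sXY /indepP[B BB sYB]; apply/indepP; exists B; rewrite // (subset_trans sXY).
Qed.

Lemma indep_base X : indep Bs X -> mrk Bs <= #|X| -> X \in Bs.
Proof.
case/indepP => B BB sXB leX; suff -> : X = B by [].
by apply/eqP; rewrite eqEcard sXB card_base.
Qed.

Lemma mrank_attained E : exists2 B, B \in Bs & #|B :&: E| = mrank Bs E.
Proof.
have [B0 BB0] := set0Pn _ matBs.1.
have [|B BB eqB] := @eq_bigmax_cond _ [in Bs] (fun B => #|B :&: E|).
  by apply/card_gt0P; exists B0.
by exists B.
Qed.

Lemma indep_augment I J : indep Bs I -> indep Bs J -> #|I| < #|J| ->
  exists2 e, e \in J :\: I & indep Bs (e |: I).
Proof.
case/indepP => B1 BB1 sIB1 /indepP[B2 BB2 sJB2] ltIJ.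
(* Among the bases containing I, take one closest to B2. *)
have := @arg_maxnP _ B1 [pred B | (B \in Bs) && (I \subset B)]
          (fun B => #|B :&: B2|).
rewrite /= BB1 sIB1 => /(_ isT) [B /andP[BB sIB] maxB].
have [|noe] := boolP [exists e in J :\: I, e \in B].
  case/exists_inP => e eJI eB; exists e => //; apply/indepP; exists B => //.
  by rewrite subUset sub1set eB.
(* If B misses [J :\: I], then J splits into [J :&: B], inside [I :&: J], and [J :\: B], no larger
   than [B2 :\: B]. The latter has the size of [B :\: B2], hence at most that of [I :\: J]; so J
   would not be larger than I. *)
have sBIB2 : B :\: B2 \subset I :\: J.
  apply/subsetP => x xBB2; have := xBB2; rewrite inE => /andP[xB2 xB].
  rewrite inE (contra (subsetP sJB2 x)) //=; apply/negPn/negP => xI.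
  have [y yB2B BB'] := base_exchange BB BB2 xBB2.
  move: yB2B; rewrite inE => /andP[yB yB2].
  have := maxB (y |: B :\ x); rewrite /= BB' /=.
  have -> : I \subset y |: B :\ x.
    apply/subsetP => z zI; rewrite !inE (subsetP sIB) // andbT.
    by apply/orP; right; apply: contraNneq xI => <-.
  move=> /(_ isT) /=; rewrite leqNgt => /negP; apply.
  apply: proper_card; apply/properP; split.
    apply/subsetP => z; rewrite !inE => /andP[zB zB2]; rewrite zB zB2 !andbT.
    by apply/orP; right; apply: contraNneq xB2 => <-.
  by exists y; rewrite !inE ?eqxx ?(negbTE yB).
have sJBI : J :&: B \subset I :&: J.
  apply/subsetP => x; rewrite !inE => /andP[xJ xB]; rewrite xJ andbT.
  apply/negPn/negP => xI; case/negP: noe; apply/exists_inP; exists x => //.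
  by rewrite inE xI.
have sJB : J :\: B \subset B2 :\: B by apply: setSD.
have := subset_leq_card sBIB2; have := subset_leq_card sJBI.
have := subset_leq_card sJB.
have := cardsID B J; have := cardsID J I.
have := cardsID B B2; have := cardsID B2 B; rewrite (setIC B2).
rewrite (card_base BB) (card_base BB2); lia.
Qed.

End MatroidBases.

(** * Two facts on finite sets *)

Lemma subset_with_card (T : finType) (A : {set T}) k : k <= #|A| ->
  exists2 X : {set T}, X \subset A & #|X| = k.
Proof.
elim: k => [|k IHk] ltkA; first by exists set0; rewrite ?sub0set ?cards0.
have [X sXA cardX] := IHk (ltnW ltkA).
have /properP[_ [x xA xX]] : X \proper A by rewrite properEcard sXA cardX.
by exists (x |: X); rewrite ?subUset ?sub1set ?xA // cardsU1 xX cardX.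
Qed.

Lemma setIU_split (T : finType) (E X Y : {set T}) :
  X \subset E -> Y \subset ~: E -> (X :|: Y) :&: E = X.
Proof.
move=> sXE sYE; rewrite setIUl (setIidPl sXE); apply/setUidPl.
suff -> : Y :&: E = set0 by rewrite sub0set.
by apply: disjoint_setI0; rewrite disjoints_subset.
Qed.

(** * The cut of a matroid along a good partition *)

Definition cut_bases n (Bs : {set {set 'I_n}}) (E : {set 'I_n}) (k : nat) :=
  [set B in Bs | #|B :&: E| <= k].

(** This form of a good partition is symmetric under exchanging E with its complement, so every
    result on M1 also serves for M2. *)
Definition cut_pair n (Bs : {set {set 'I_n}}) (E : {set 'I_n}) (k1 k2 : nat) :=
  [/\ k1 + k2 = mrk Bs, k1 < mrank Bs E, k2 < mrank Bs (~: E) &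
      forall X Y : {set 'I_n},
        X \subset E -> indep Bs X -> #|X| <= k1 ->
        Y \subset ~: E -> indep Bs Y -> #|Y| <= k2 -> indep Bs (X :|: Y)].

(** The truncated subtractions are exact because a1 < r1 and a2 < r2; positivity of a1 and a2 makes
    the rank bounds strict. *)
Lemma good_partition_cut_pair n (Bs : {set {set 'I_n}}) (E : {set 'I_n}) a1 a2 :
  good_partition_with Bs E (~: E) a1 a2 ->
  cut_pair Bs E (mrank Bs E - a1) (mrank Bs (~: E) - a2).
Proof. by case=> [_ ? ? ? P2]; split=> //; lia. Qed.

Lemma cut_pairC n (Bs : {set {set 'I_n}}) (E : {set 'I_n}) k1 k2 :
  cut_pair Bs E k1 k2 -> cut_pair Bs (~: E) k2 k1.
Proof.
case=> k12 lt1 lt2 P2; split; rewrite ?setCK 1?addnC // => X Y *.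
by rewrite setUC; apply: P2.
Qed.

(** * The bases on one side of the cut form a matroid *)

Section CutMatroid.
Variables (n : nat) (Bs : {set {set 'I_n}}) (E : {set 'I_n}) (k1 k2 : nat).
Hypotheses (matBs : matroid_bases Bs) (cutBs : cut_pair Bs E k1 k2).

Lemma cut_matroid : matroid_bases (cut_bases Bs E k1).
Proof.
have [k12 lt1 lt2 P2] := cutBs; split.
  (* Nonemptiness: a k1-subset of E and a k2-subset of its complement, both independent, have an
     independent union by (P2), and its size is r. *)
  have [B1 BB1 cardB1] := mrank_attained matBs E.
  have [B2 BB2 cardB2] := mrank_attained matBs (~: E).
  have [X] := @subset_with_card _ (B1 :&: E) k1 ltac:(lia).
  rewrite subsetI => /andP[sXB1 sXE] cardX.
  have [Y] := @subset_with_card _ (B2 :&: ~: E) k2 ltac:(lia).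
  rewrite subsetI => /andP[sYB2 sYE] cardY.
  have XYE : (X :|: Y) :&: E = X by apply: setIU_split.
  have XYE' : (X :|: Y) :&: ~: E = Y by rewrite setUC setIU_split ?setCK.
  apply/set0Pn; exists (X :|: Y); rewrite inE XYE cardX leqnn andbT.
  apply: indep_base => //.
    apply: P2; rewrite ?cardX ?cardY //; apply/indepP; first by exists B1.
    by exists B2.
  by rewrite -(cardsID E (X :|: Y)) XYE setDE XYE' cardX cardY k12.
move=> B C; rewrite !inE => /andP[BB leB] /andP[BC leC] x xBC.
have /setDP[xB xC] := xBC.
have indB : indep Bs B by apply/indepP; exists B.
have indC : indep Bs C by apply/indepP; exists C.
have cardB := card_base matBs BB; have cardC := card_base matBs BC.
have cardBx := cardsD1 x B; rewrite xB cardB in cardBx.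
have cardBxE := cardsID E (B :\ x).
(* With fewer than k1 elements of [B :\ x] in E, any y allowed by M keeps the new base within the
   bound. *)
have [ltBx|geBx] := ltnP #|(B :\ x) :&: E| k1.
  have [y yCB BB'] := base_exchange matBs BB BC xBC; exists y => //.
  rewrite inE BB' /= setIUl (leq_trans _ ltBx) //.
  apply: leq_trans (leq_card_setU _ _) _; rewrite -add1n leq_add2r.
  by rewrite -(cards1 y) subset_leq_card // subsetIl.
(* Now B has exactly k1 elements in E and x lies outside E, so the exchange
   can be carried out inside the complement of E, where (P2) applies. *)
have eqBx : #|(B :\ x) :&: E| = k1.
  apply/eqP; rewrite eqn_leq geBx andbT; apply: leq_trans leB.
  by apply: subset_leq_card; rewrite setSI ?subsetDl.
(* [(B :\ x) :\: E] has k2 - 1 elements, whereas [C :\: E] has at least k2, since at most k1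
   elements of C lie in E. *)
have [y yCB' indY] : exists2 y, y \in (C :\: E) :\: ((B :\ x) :\: E)
    & indep Bs (y |: ((B :\ x) :\: E)).
  apply: indep_augment => //.
  - by apply: indep_sub indB; rewrite (subset_trans (subsetDl _ _)) ?subsetDl.
  - by apply: indep_sub indC; rewrite subsetDl.
  have := cardsID E C; lia.
have /setDP[/setDP[yC yE] yBx] := yCB'.
have yB : y \notin B.
  apply: contra yBx => yB; rewrite !inE yE yB andbT /=.
  by apply: contraNneq xC => <-.
have eqU : y |: B :\ x = ((B :\ x) :&: E) :|: (y |: ((B :\ x) :\: E)).
  by rewrite setUCA setID.
exists y; first by rewrite inE yB.
rewrite inE; apply/andP; split.
  apply: indep_base => //; last by rewrite card_swap ?cardB.
  rewrite eqU; apply: P2 => //; rewrite ?subsetIr ?eqBx //.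
  - apply: indep_sub indB.
    by rewrite (subset_trans (subsetIl _ _)) ?subsetDl.
  - by rewrite subUset sub1set inE yE setDE subsetIr.
  rewrite cardsU1 yBx; lia.
rewrite setIUl; apply: leq_trans (leq_card_setU _ _) _.
rewrite eqBx; suff -> : [set y] :&: E = set0 by rewrite cards0.
by apply: disjoint_setI0; rewrite disjoints1.
Qed.

End CutMatroid.

(** * Nonnegative combinations of indicators *)

Section Conic.
Variables (R : realFieldType) (n : nat).
Local Open Scope ring_scope.
Implicit Types (F G : {set {set 'I_n}}) (A B E : {set 'I_n}) (x y : 'rV[R]_n).

(* The cone over the polytope of F, with the total weight m recorded, so that
   [conic F 1] is [base_polytope F] on the nose. *)
Definition conic F (m : R) x : Prop :=
  exists w : {set 'I_n} -> R,
    [/\ forall B, 0 <= w B, \sum_(B in F) w B = m &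
        x = \sum_(B in F) w B *: indicator R B].

(** Indices with the same image are grouped together. Only indices of nonzero weight need their
    image in F, so a family can be shrunk to the support of the weights. *)
Lemma conic_push (I : finType) (P : pred I) (w : I -> R) (g : I -> {set 'I_n}) F :
  (forall i, P i -> 0 <= w i) -> (forall i, P i -> w i != 0 -> g i \in F) ->
  conic F (\sum_(i | P i) w i) (\sum_(i | P i) w i *: indicator R (g i)).
Proof.
move=> w_ge0 gF; pose Q i := P i && (w i != 0).
have gQ i : Q i -> g i \in F by case/andP => Pi /(gF i Pi).
exists (fun B => \sum_(i | Q i && (g i == B)) w i); split.
- by move=> B; apply: sumr_ge0 => i /andP[/andP[Pi _] _]; apply: w_ge0.
- rewrite -(partition_big g (mem F)) // /Q big_mkcondr /=.
  by apply: eq_bigr => i _; case: eqP.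
transitivity (\sum_(i | Q i) w i *: indicator R (g i)).
  rewrite /Q big_mkcondr /=; apply: eq_bigr => i _.
  by case: eqP => //= ->; rewrite scale0r.
rewrite (partition_big g (mem F)) //=; apply: eq_bigr => B _.
by rewrite scaler_suml; apply: eq_bigr => i /andP[_ /eqP->].
Qed.

Lemma conicD F m1 m2 x1 x2 :
  conic F m1 x1 -> conic F m2 x2 -> conic F (m1 + m2) (x1 + x2).
Proof.
move=> [w1 [w1_ge0 <- ->]] [w2 [w2_ge0 <- ->]].
exists (fun B => w1 B + w2 B); split => [B||]; first exact: addr_ge0.
  by rewrite big_split.
by rewrite -big_split; apply: eq_bigr => B _; rewrite scalerDl.
Qed.

Lemma conic_sub F G m x : F \subset G -> conic F m x -> conic G m x.
Proof.
move=> /subsetP sFG [w [w_ge0 <- ->]]; apply: conic_push => // B BF _.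
exact: sFG.
Qed.

Lemma conic_mass0 F x : conic F 0 x -> x = 0.
Proof.
move=> [w [w_ge0 w0 ->]]; apply: big1 => B BF.
by rewrite (psumr_eq0P _ w0) ?scale0r.
Qed.

Lemma conic00 F : conic F 0 0.
Proof. by exists (fun=> 0); split => //; rewrite big1 // => B _; rewrite scale0r. Qed.

Lemma indicator_split E B :
  indicator R B = indicator R (B :&: E) + indicator R (B :&: ~: E).
Proof.
apply/rowP => i; rewrite !mxE !inE.
by case: (i \in B); case: (i \in E); rewrite /= ?addr0 ?add0r.
Qed.

(** This identity is why moving an element from a large set to a small one leaves the represented
    point unchanged. *)
Lemma indicatorU1D1 A B i : i \in B :\: A ->
  indicator R (i |: A) + indicator R (B :\ i) = indicator R A + indicator R B.
Proof.
case/setDP => iB iA; apply/rowP => j; rewrite !mxE !inE.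
case: eqP => [->|_] /=; first by rewrite iB (negbTE iA) addr0 add0r.
by [].
Qed.

Lemma dotv_indicator E B :
  dotv (indicator R E) (indicator R B) = #|B :&: E|%:R.
Proof.
rewrite /dotv -sum1_card natr_sum [RHS]big_mkcond; apply: eq_bigr => i _.
by rewrite !mxE inE; case: (i \in B); case: (i \in E); rewrite /= ?mulr0 ?mul0r ?mulr1.
Qed.

Lemma dotv_sum (I : finType) (P : pred I) (w : I -> R) (u : I -> 'rV[R]_n) c :
  dotv c (\sum_(i | P i) w i *: u i) = \sum_(i | P i) w i * dotv c (u i).
Proof.
rewrite /dotv; under eq_bigr do rewrite summxE mulr_sumr.
rewrite exchange_big; apply: eq_bigr => i _; rewrite mulr_sumr.
by apply: eq_bigr => j _; rewrite mxE mulrCA.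
Qed.

Lemma dotv_comb E (I : finType) (P : pred I) (w : I -> R) (g : I -> {set 'I_n}) :
  dotv (indicator R E) (\sum_(i | P i) w i *: indicator R (g i)) =
  \sum_(i | P i) w i * #|g i :&: E|%:R.
Proof. by rewrite dotv_sum; under eq_bigr do rewrite dotv_indicator. Qed.

Lemma dotv_conic_le F m x E k : (forall B, B \in F -> (#|B :&: E| <= k)%N) ->
  conic F m x -> dotv (indicator R E) x <= k%:R * m.
Proof.
move=> leF [w [w_ge0 <- ->]]; rewrite dotv_comb mulr_sumr ler_sum // => B BF.
by rewrite mulrC ler_wpM2r // ler_nat leF.
Qed.

(** * Concentrating a combination on sets of one size *)

Section Levels.
Variable F : {set {set 'I_n}}.
(** For independent sets inside a fixed set this is augmentation together with closure under
    subsets. *)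
Hypothesis augF : forall A B, A \in F -> B \in F -> (#|A| < #|B|)%N ->
  exists i, [/\ i \in B :\: A, i |: A \in F & B :\ i \in F].

Definition levels lo hi := [set A in F | (lo <= #|A| <= hi)%N].

(* Each exchange empties one of two extreme sets and only feeds sets of
   intermediate size. *)
Lemma levels_shrink lo hi m x : (lo.+1 < hi)%N -> conic (levels lo hi) m x ->
  conic (levels lo.+1 hi) m x \/ conic (levels lo hi.-1) m x.
Proof.
move=> lt_lh.
(* The exchanged sets have sizes lo + 1 and hi - 1, and neither is extreme. *)
have midA : (lo.+1 == lo) || (lo.+1 == hi) = false by lia.
have midB : (hi.-1 == lo) || (hi.-1 == hi) = false by lia.
have le_lh1 : (lo <= hi.-1)%N by lia.
have le_lh : (lo <= hi)%N by lia.
case=> w; pose ext (w : {set 'I_n} -> R) :=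
  [set A in levels lo hi | (w A != 0) && ((#|A| == lo) || (#|A| == hi))].
(* Induction on the number of extreme sets in the support; once one extreme size is absent, the
   range shrinks at that end. *)
move: {2}#|ext w| (leqnn #|ext w|) => d.
elim: d w => [|d IHd] w le_d [w_ge0 w_m w_x].
  left; rewrite -w_m w_x; apply: conic_push => // A AF wA.
  have : A \notin ext w by move: le_d; rewrite leqn0 cards_eq0 => /eqP->; rewrite inE.
  move: AF; rewrite !inE wA => /and3P[-> ge_lo le_hi]; rewrite ge_lo le_hi; lia.
have [/exists_inP[A Aext /eqP cardA]|noA] :=
    boolP [exists A in ext w, #|A| == lo]; last first.
  left; rewrite -w_m w_x; apply: conic_push => // A AF wA.
  have /exists_inPn/(_ A) := noA; move: AF; rewrite !inE wA => /and3P[-> ge_lo le_hi].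
  by rewrite ge_lo le_hi andbT ltn_neqAle ge_lo eq_sym; case: eqP => // _ /(_ isT).
have [/exists_inP[B Bext /eqP cardB]|noB] :=
    boolP [exists B in ext w, #|B| == hi]; last first.
  right; rewrite -w_m w_x; apply: conic_push => // B BF wB.
  have /exists_inPn/(_ B) := noB; move: BF; rewrite !inE wB => /and3P[-> ge_lo le_hi].
  rewrite ge_lo [(_ <= hi)%N in X in X -> _]le_hi /= orbC; case: eqVneq => [_ /(_ isT) //|ne_hi _].
  have lt_hi : (#|B| < hi)%N by rewrite ltn_neqAle ne_hi.
  by rewrite -ltnS prednK // (leq_ltn_trans _ lt_hi).
have [AF wA] : A \in F /\ w A != 0 by move: Aext; rewrite !inE => /and3P[/and3P[]].
have [BF wB] : B \in F /\ w B != 0 by move: Bext; rewrite !inE => /and3P[/and3P[]].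
have ltAB : (#|A| < #|B|)%N by rewrite cardA cardB ltnW.
have [i [iBA A'F B'F]] := augF AF BF ltAB.
have /setDP[iB iA] := iBA.
have cardA' : #|i |: A| = lo.+1 by rewrite cardsU1 iA cardA.
have cardB' : #|B :\ i| = hi.-1 by rewrite -cardB (cardsD1 i B) iB.
have AL : A \in levels lo hi by rewrite inE AF cardA leqnn.
have BL : B \in levels lo hi by rewrite inE BF cardB leqnn andbT.
have A'L : i |: A \in levels lo hi by rewrite inE A'F cardA' leqnSn ltnW.
have B'L : B :\ i \in levels lo hi by rewrite inE B'F cardB' le_lh1 leq_pred.
(* Moving the smaller of the two weights makes the weight of A or of B vanish and keeps the other
   nonnegative. *)
pose dl := Num.min (w A) (w B).
have dl_ge0 : 0 <= dl by rewrite le_min !w_ge0.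
have neqAB : A != B by apply/eqP => eqAB; move: lt_lh; rewrite -cardA -cardB eqAB ltnNge leqnSn.
pose v C := w C - dl * (C == A)%:R - dl * (C == B)%:R
            + dl * (C == i |: A)%:R + dl * (C == B :\ i)%:R.
have v_ext (C : {set 'I_n}) : (#|C| == lo) || (#|C| == hi) ->
    v C = w C - dl * (C == A)%:R - dl * (C == B)%:R.
  move=> extC; rewrite /v.
  have /negbTE-> : C != i |: A by apply: contraTneq extC => ->; rewrite cardA' midA.
  have /negbTE-> : C != B :\ i by apply: contraTneq extC => ->; rewrite cardB' midB.
  by rewrite !mulr0 !addr0.
(* Used twice: with f constant for the total weight, and with f the indicator for the point. *)
have v_sum (V : lmodType R) (f : {set 'I_n} -> V) :
    f (i |: A) + f (B :\ i) = f A + f B ->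
    \sum_(C in levels lo hi) v C *: f C = \sum_(C in levels lo hi) w C *: f C.
  move=> fE; have pick D : D \in levels lo hi ->
      \sum_(C in levels lo hi) (dl * (C == D)%:R) *: f C = dl *: f D.
    move=> DL; rewrite (bigD1 D) //= eqxx mulr1 big1 ?addr0 // => C /andP[_ /negbTE->].
    by rewrite mulr0 scale0r.
  under eq_bigr do rewrite /v !scalerDl !scaleNr.
  rewrite !big_split /= !sumrN !pick //.
  by rewrite -addrA -scalerDr fE scalerDr -[_ - _ - _]addrA -opprD subrK.
apply: (IHd v).
  rewrite -ltnS; apply: leq_trans le_d; apply: proper_card; apply/properP; split.
    apply/subsetP => C; rewrite !inE => /andP[-> /andP[vC extC]] /=; rewrite extC andbT.
    apply: contraNneq vC => wC; rewrite v_ext //.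
    have /negbTE-> : C != A by apply: contraNneq wA => <-; rewrite wC.
    have /negbTE-> : C != B by apply: contraNneq wB => <-; rewrite wC.
    by rewrite wC !mulr0 !subr0.
  have [leAB|ltBA] := leP (w A) (w B).
    exists A => //; rewrite !inE v_ext ?cardA ?eqxx // (negbTE neqAB).
    by rewrite /dl (min_idPl leAB) mulr1 mulr0 subr0 subrr eqxx !andbF.
  exists B => //; rewrite !inE v_ext ?cardB ?eqxx ?orbT // [B == A]eq_sym (negbTE neqAB).
  by rewrite /dl (min_idPr (ltW ltBA)) mulr1 mulr0 subr0 subrr eqxx !andbF.
split.
- move=> C; rewrite /v; do 2![apply: addr_ge0; last by rewrite mulr_ge0].
  have [->|_] := eqVneq C A.
    by rewrite (negbTE neqAB) mulr1 mulr0 subr0 subr_ge0 ge_min lexx.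
  have [->|_] := eqVneq C B.
    by rewrite mulr1 mulr0 subr0 subr_ge0 ge_min lexx orbT.
  by rewrite !mulr0 !subr0.
- have := v_sum R^o (fun=> 1) erefl; rewrite -w_m => eq_m.
  apply: etrans (etrans eq_m _); apply: eq_bigr => C _; last exact: mulr1.
  exact/esym/mulr1.
by rewrite w_x v_sum ?indicatorU1D1.
Qed.

(** The range shrinks until k is no longer strictly inside it. All deviations from k then have one
    sign and weighted mean zero, so only sets of size k carry weight. *)
Lemma levels_average lo hi k m x : conic (levels lo hi) m x ->
  dotv (indicator R setT) x = k%:R * m -> conic (levels k k) m x.
Proof.
move=> + x_avg.
(* The factor s, later 1 or -1, makes all deviations nonnegative. *)
have one_sided lo' hi' (s : R) : s != 0 ->
    (forall A, A \in levels lo' hi' -> 0 <= s * (#|A|%:R - k%:R)) ->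
    conic (levels lo' hi') m x -> conic (levels k k) m x.
  move=> s_neq0 s_ge0 [w [w_ge0 w_m w_x]].
  have sum0 : \sum_(A in levels lo' hi') w A * (s * (#|A|%:R - k%:R)) = 0.
    under eq_bigr do rewrite mulrCA mulrBr; rewrite -mulr_sumr sumrB -mulr_suml w_m.
    move: x_avg; rewrite w_x dotv_comb; under eq_bigr do rewrite setIT.
    by move=> ->; rewrite mulrC [m * _]mulrC subrr mul0r.
  rewrite -w_m w_x; apply: conic_push => // A AL wA.
  have ge0 C : C \in levels lo' hi' -> 0 <= w C * (s * (#|C|%:R - k%:R)).
    by move=> CL; rewrite mulr_ge0 ?s_ge0.
  have /eqP := psumr_eq0P ge0 sum0 AL.
  rewrite mulf_eq0 (negbTE wA) mulf_eq0 (negbTE s_neq0) subr_eq0 eqr_nat /=.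
  by move: AL; rewrite !inE => /andP[-> _] /eqP->; rewrite leqnn.
move: {2}(hi - lo)%N (leqnn (hi - lo)) => d.
have base lo' hi' : (k <= lo')%N || (hi' <= k)%N ->
    conic (levels lo' hi') m x -> conic (levels k k) m x.
  case/orP => [le_k|le_k]; [apply: (one_sided _ _ 1) | apply: (one_sided _ _ (-1))];
    rewrite ?oppr_eq0 ?oner_eq0 // => A; rewrite inE => /and3P[_ leA geA].
    by rewrite mul1r subr_ge0 ler_nat (leq_trans le_k).
  by rewrite mulN1r opprB subr_ge0 ler_nat (leq_trans geA).
elim: d lo hi => [|d IHd] lo hi le_d.
  by apply: base; lia.
have [|/norP[]] := boolP ((k <= lo)%N || (hi <= k)%N); first exact: base.
rewrite -!ltnNge => lt_lo lt_hi.
case/levels_shrink => [|/IHd|/IHd]; first by lia.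
  by apply; lia.
by apply; lia.
Qed.

End Levels.
End Conic.

(** * The cut polytope as a half of the base polytope *)

Section CutPolytope.
Variables (R : realFieldType) (n : nat) (Bs : {set {set 'I_n}}).
Hypothesis matBs : matroid_bases Bs.
Local Open Scope ring_scope.
Implicit Types (B X Y E : {set 'I_n}) (x : 'rV[R]_n).

Definition indeps_in E := [set X : {set 'I_n} | (X \subset E) && indep Bs X].

(** The traces of the bases on E are independent, have mean size k and sizes between 0 and n;
    matroid augmentation supplies the exchange that averaging requires. *)
Lemma conic_truncate E k (w : {set 'I_n} -> R) : (forall B, 0 <= w B) ->
  \sum_(B in Bs) w B * #|B :&: E|%:R = k%:R * \sum_(B in Bs) w B ->
  conic (levels (indeps_in E) k k) (\sum_(B in Bs) w B)
    (\sum_(B in Bs) w B *: indicator R (B :&: E)).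
Proof.
move=> w_ge0 w_avg.
apply: (@levels_average _ _ _ _ 0 n); last first.
- by rewrite dotv_comb -w_avg; apply: eq_bigr => B _; rewrite setIT.
- apply: conic_push => // B BB _; rewrite !inE subsetIr /=.
  rewrite -[n in (_ <= n)%N]card_ord max_card andbT.
  by apply/indepP; exists B; rewrite // subsetIl.
move=> A B; rewrite !inE => /andP[sAE indA] /andP[sBE indB] ltAB.
have [i iBA indiA] := indep_augment matBs indA indB ltAB.
have /setDP[iB _] := iBA; exists i; split => //; rewrite inE.
  by rewrite subUset sub1set (subsetP sBE) ?sAE.
by rewrite (subset_trans (subsetDl _ _) sBE) (indep_sub _ indB) ?subsetDl.
Qed.

Lemma dotv_conic_total E m x : conic Bs m x ->
  dotv (indicator R E) x + dotv (indicator R (~: E)) x = (mrk Bs)%:R * m.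
Proof.
case=> w [_ <- ->]; rewrite !dotv_comb -big_split mulr_sumr.
apply: eq_bigr => B BB /=.
by rewrite -mulrDr -natrD -setDE cardsID (card_base matBs) // mulrC.
Qed.

Variables (E : {set 'I_n}) (k1 k2 : nat).
Hypothesis cutBs : cut_pair Bs E k1 k2.

Lemma cut_union X Y :
  X \in levels (indeps_in E) k1 k1 -> Y \in levels (indeps_in (~: E)) k2 k2 ->
  [/\ (X :|: Y) :&: E = X, (X :|: Y) :&: ~: E = Y & X :|: Y \in Bs].
Proof.
have [k12 _ _ P2] := cutBs.
rewrite !inE -!eqn_leq => /andP[/andP[sXE indX] /eqP cardX].
move=> /andP[/andP[sYE indY] /eqP cardY].
have XYE : (X :|: Y) :&: E = X by apply: setIU_split.
have XYE' : (X :|: Y) :&: ~: E = Y by rewrite setUC setIU_split ?setCK.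
split=> //; apply: indep_base => //; first by apply: P2; rewrite -?cardX -?cardY.
by rewrite -(cardsID E (X :|: Y)) XYE setDE XYE' -cardX -cardY k12.
Qed.

(* By (P2), the bases on the cutting hyperplane are the unions of an arbitrary
   k1-element independent subset of E and an arbitrary k2-element independent
   subset of its complement, so product weights can be used. *)
Lemma conic_on_cut m x : conic Bs m x ->
  dotv (indicator R E) x = k1%:R * m -> conic (cut_bases Bs E k1) m x.
Proof.
move=> conx x_avg.
have [m0|m_neq0] := eqVneq m 0.
  by move: conx; rewrite m0 => /conic_mass0->; apply: conic00.
have [k12 _ _ _] := cutBs.
have x_avg' : dotv (indicator R (~: E)) x = k2%:R * m.
  have := dotv_conic_total E conx; rewrite x_avg -k12 natrD mulrDl.
  exact: addrI.
case: conx => w [w_ge0 w_m w_x].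
have [u1 [u1_ge0 u1_m u1_x]] : conic (levels (indeps_in E) k1 k1) m
    (\sum_(B in Bs) w B *: indicator R (B :&: E)).
  by rewrite -w_m; apply: conic_truncate; rewrite // w_m -x_avg w_x dotv_comb.
have [u2 [u2_ge0 u2_m u2_x]] : conic (levels (indeps_in (~: E)) k2 k2) m
    (\sum_(B in Bs) w B *: indicator R (B :&: ~: E)).
  by rewrite -w_m; apply: conic_truncate; rewrite // w_m -x_avg' w_x dotv_comb.
pose P (p : {set 'I_n} * {set 'I_n}) :=
  (p.1 \in levels (indeps_in E) k1 k1) && (p.2 \in levels (indeps_in (~: E)) k2 k2).
(* Both families have total weight m, so after division by m the product weights have marginals [u1]
   and [u2]; hence m = 0 was treated apart. *)
pose u (p : {set 'I_n} * {set 'I_n}) := u1 p.1 * u2 p.2 / m.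
have m_ge0 : 0 <= m by rewrite -w_m sumr_ge0.
have u_sum1 X : \sum_(Y in levels (indeps_in (~: E)) k2 k2) u (X, Y) = u1 X.
  by rewrite /u /= -mulr_suml -mulr_sumr u2_m mulfK.
have u_sum2 Y : \sum_(X in levels (indeps_in E) k1 k1) u (X, Y) = u2 Y.
  by rewrite /u /= -mulr_suml -mulr_suml u1_m mulrAC mulfV // mul1r.
have -> : m = \sum_(p | P p) u p.
  rewrite -(pair_big _ _ (fun X Y => u (X, Y))) -[LHS]u1_m.
  by apply: eq_bigr => X _; rewrite u_sum1.
have -> : x = \sum_(p | P p) u p *: indicator R (p.1 :|: p.2).
  have -> : x = \sum_(X in levels (indeps_in E) k1 k1) u1 X *: indicator R X +
                \sum_(Y in levels (indeps_in (~: E)) k2 k2) u2 Y *: indicator R Y.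
    rewrite -u1_x -u2_x w_x -big_split; apply: eq_bigr => B _ /=.
    by rewrite -scalerDr -indicator_split.
  transitivity (\sum_(p | P p) (u p *: indicator R p.1 + u p *: indicator R p.2)).
    rewrite big_split; congr (_ + _).
      rewrite -(pair_big _ _ (fun X Y => u (X, Y) *: indicator R X)) /=.
      by apply: eq_bigr => X _; rewrite -scaler_suml u_sum1.
    rewrite -(pair_big _ _ (fun X Y => u (X, Y) *: indicator R Y)) /= exchange_big /=.
    by apply: eq_bigr => Y _; rewrite -scaler_suml u_sum2.
  apply: eq_bigr => -[X Y] /andP[/= XL YL]; rewrite -scalerDr.
  by have [XE YE _] := cut_union XL YL; rewrite (indicator_split R E (X :|: Y)) XE YE.
apply: conic_push => [[X Y] _|[X Y] /andP[/= XL YL] _].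
  by rewrite /u divr_ge0 ?mulr_ge0.
have [XE _ XYB] := cut_union XL YL; rewrite inE XYB XE.
by move: XL; rewrite inE => /and3P[].
Qed.

Lemma cut_polytopeP x : base_polytope (cut_bases Bs E k1) x <->
  base_polytope Bs x /\ dotv (indicator R E) x <= k1%:R.
Proof.
split=> [Px | [[w [w_ge0 w_m w_x]] le_x]].
  split; first by apply: conic_sub Px; apply/subsetP => B; rewrite inE => /andP[].
  by rewrite -[k1%:R]mulr1; apply: dotv_conic_le Px => B; rewrite inE => /andP[].
(* Mix the bases above the hyperplane with a fraction t of those below it, so
   that the mixture lies on the hyperplane. *)
pose up B := (k1 < #|B :&: E|)%N.
(* H is the total excess above the hyperplane and L the total deficit below it; H - L = x(E) -
   k1. *)
pose H := \sum_(B in Bs | up B) w B * (#|B :&: E|%:R - k1%:R).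
pose L := \sum_(B in Bs | ~~ up B) w B * (k1%:R - #|B :&: E|%:R).
have H_ge0 : 0 <= H.
  by apply: sumr_ge0 => B /andP[_ /ltnW upB]; rewrite mulr_ge0 ?subr_ge0 ?ler_nat.
have L_ge0 : 0 <= L.
  by apply: sumr_ge0 => B /andP[_]; rewrite -leqNgt => dnB; rewrite mulr_ge0 ?subr_ge0 ?ler_nat.
have le_HL : H <= L.
  move: le_x; rewrite -subr_le0 => /(le_trans _) le0.
  rewrite -subr_le0; apply: le0.
  have -> : k1%:R = \sum_(B in Bs) w B * k1%:R :> R by rewrite -mulr_suml w_m mul1r.
  rewrite w_x dotv_comb -sumrB [leRHS](bigID up) /= -sumrN lerD //.
    by apply: ler_sum => B _; rewrite mulrBr lexx.
  by apply: ler_sum => B _; rewrite -mulrN opprB mulrBr lexx.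
(* If L = 0 then H = 0 as well, and the convention for division by zero gives t = 0, so t L = H
   still holds. *)
pose t := H / L.
have t_ge0 : 0 <= t by rewrite divr_ge0.
have tL : t * L = H.
  have [L0|L_neq0] := eqVneq L 0; last by rewrite divfK.
  by apply/eqP; rewrite L0 mulr0 eq_le H_ge0 -L0 le_HL.
have t_le1 : t <= 1.
  have [L0|L_neq0] := eqVneq L 0; first by rewrite /t L0 invr0 mulr0.
  by rewrite ler_pdivrMr ?mul1r // lt_def L_neq0.
pose v B := if up B then w B else t * w B.
have v_ge0 B : 0 <= v B by rewrite /v; case: ifP => _; [exact: w_ge0 | exact: mulr_ge0].
have con_v : conic (cut_bases Bs E k1) (\sum_(B in Bs) v B)
    (\sum_(B in Bs) v B *: indicator R B).
  apply: conic_on_cut; first by exists v.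
  rewrite dotv_comb; apply/eqP; rewrite -subr_eq0 mulr_sumr -sumrB (bigID up) /=.
  apply/eqP; transitivity (H - t * L); last by rewrite tL subrr.
  rewrite [t * L]mulr_sumr -[in RHS]sumrN.
  congr (_ + _); apply: eq_bigr => B /andP[_]; rewrite /v; first by move->; ring.
  by move/negbTE->; ring.
(* The remaining weight w - v sits only on bases below or on the hyperplane, which all belong to the
   cut. *)
have con_d : conic (cut_bases Bs E k1) (\sum_(B in Bs | ~~ up B) (w B - v B))
    (\sum_(B in Bs | ~~ up B) (w B - v B) *: indicator R B).
  apply: conic_push => B /andP[BB dnB]; last by rewrite inE BB leqNgt dnB.
  by rewrite /v (negbTE dnB) subr_ge0 ler_piMl.
have v_up B : up B -> v B = w B by rewrite /v => ->.
have := conicD con_v con_d; rewrite /base_polytope -/(conic _ 1 x); congr conic.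
  rewrite -w_m (bigID up) [RHS](bigID up) /= -addrA -big_split /=; congr (_ + _).
    by apply: eq_bigr => B /andP[_ /v_up].
  by apply: eq_bigr => B _; rewrite addrC subrK.
rewrite w_x (bigID up) [RHS](bigID up) /= -addrA -big_split /=; congr (_ + _).
  by apply: eq_bigr => B /andP[_ /v_up->].
by apply: eq_bigr => B _; rewrite -scalerDl addrC subrK.
Qed.

End CutPolytope.

(** * The common face and nontriviality *)

Section Split.
Variables (R : realFieldType) (n : nat) (Bs : {set {set 'I_n}}).
Hypothesis matBs : matroid_bases Bs.
Local Open Scope ring_scope.
Implicit Types (E : {set 'I_n}) (x : 'rV[R]_n).

Lemma dotv_base_polytope E k1 k2 x : cut_pair Bs E k1 k2 -> base_polytope Bs x ->
  dotv (indicator R E) x + dotv (indicator R (~: E)) x = k1%:R + k2%:R.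
Proof.
by case=> k12 _ _ _ /(dotv_conic_total matBs E) ->; rewrite mulr1 -natrD k12.
Qed.

(** On P(M) the values x(E) and x(~: E) add up to k1 + k2, so both upper bounds hold exactly when
    x(E) = k1, given x(E) <= k1. *)
Lemma cut_polytope_face E k1 k2 : cut_pair Bs E k1 k2 ->
  is_face (base_polytope (R := R) (cut_bases Bs E k1))
    (fun x => base_polytope (cut_bases Bs E k1) x /\
              base_polytope (cut_bases Bs (~: E) k2) x).
Proof.
move=> cutBs; have cutBs' := cut_pairC cutBs.
exists (indicator R E), k1%:R; split=> [x | x].
  by move=> /(cut_polytopeP matBs cutBs)[].
split=> [[P1x /(cut_polytopeP matBs cutBs')[_ le2]] | [P1x eq1]]; split=> //.
  have /(cut_polytopeP matBs cutBs)[Px le1] := P1x.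
  by have := dotv_base_polytope cutBs Px; lra.
have /(cut_polytopeP matBs cutBs)[Px _] := P1x.
apply/(cut_polytopeP matBs cutBs'); split=> //.
by have := dotv_base_polytope cutBs Px; lra.
Qed.

(** A base attaining the rank of E has more than k1 elements in E, so its vertex is cut off. *)
Lemma cut_polytope_proper E k1 k2 : cut_pair Bs E k1 k2 ->
  ~ same_pred (base_polytope (R := R) (cut_bases Bs E k1)) (base_polytope Bs).
Proof.
move=> cutBs eqP; have [_ lt1 _ _] := cutBs.
have [B BB cardB] := mrank_attained matBs E.
have PB : base_polytope Bs (indicator R B).
  exists (fun C => (C == B)%:R); split=> [C||]; first exact: ler0n.
    by rewrite (bigD1 B) //= eqxx big1 ?addr0 // => C /andP[_ /negbTE->].
  by rewrite (bigD1 B) //= eqxx scale1r big1 ?addr0 // => C /andP[_ /negbTE->]; rewrite scale0r.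
have /eqP/(cut_polytopeP matBs cutBs)[_] := PB.
by rewrite dotv_indicator cardB ler_nat leqNgt lt1.
Qed.

End Split.

Theorem theorem1 (R : realFieldType) (n : nat) (Bs : {set {set 'I_n}})
  (E1 : {set 'I_n}) (a1 a2 : nat) :
  matroid_bases Bs ->
  good_partition_with Bs E1 (~: E1) a1 a2 ->
  nontrivial_hyperplane_split R Bs
    [set B in Bs | #|B :&: E1| <= mrank Bs E1 - a1]
    [set B in Bs | #|B :&: ~: E1| <= mrank Bs (~: E1) - a2].
Proof.
move=> matBs /good_partition_cut_pair cut1; have cut2 := cut_pairC cut1.
rewrite -!/(cut_bases _ _ _).
split; [split | exact: cut_polytope_proper cut1 | exact: cut_polytope_proper cut2].
- exact: cut_matroid cut1.
- exact: cut_matroid cut2.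
- move=> x; split=> [Px | [/(cut_polytopeP matBs cut1)[] | /(cut_polytopeP matBs cut2)[]] //].
  have := dotv_base_polytope matBs cut1 Px.
  have [le1 _ | gt1 tot] := lerP (dotv (indicator R E1) x) (mrank Bs E1 - a1)%:R.
    by left; apply/(cut_polytopeP matBs cut1).
  by right; apply/(cut_polytopeP matBs cut2); split=> //; lra.
- exact: cut_polytope_face cut1.
(* Taking the complement of E1 as the cut set yields the second face with its two conjuncts in
   reverse order. *)
have [c [d [cd faceE]]] := cut_polytope_face R matBs cut2.
rewrite setCK in faceE; exists c, d; split=> // x.
by split=> [[? ?]|?]; [apply/faceE | apply/and_comm/faceE].
Qed.
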